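(* Let $(X,L,\delta)$ be a semimetric-like ordinal space. Then there exists a metric $d$ on $X$ such that the metric space $(X,d)$ has the ordinal type $(X,\delta)$; that is, such that for all $x,y,z,w\in X$ one has $\delta(x,y)<\delta(z,w)$, $\delta(x,y)=\delta(z,w)$, or $\delta(x,y)>\delta(z,w)$ in $L$ according to whether $d(x,y)<d(z,w)$, $d(x,y)=d(z,w)$, or $d(x,y)>d(z,w)$, respectively.
   Context: An ordinal space is an ordered triplet $(X,L,\delta)$, also written $(X,\delta)$, where $X$ is a set, $L$ is a linearly ordered set with minimal element $0$, and $\delta\colon X\times X\to L$ is a surjective mapping such that for all $x,y\in X$: (i) $\delta(x,y)=\delta(y,x)$; (ii) $\delta(x,y)=0$ if and only if $x=y$. A semimetric on $X$ is a function $d\colon X\times X\to[0,\infty)$ with $d(x,y)=d(y,x)$ and ($d(x,y)=0\Leftrightarrow x=y$) for all $x,y\in X$ (no triangle inequality is required). A semimetric space $(X,d)$ has the ordinal type $(X,\delta)$, and is then called a realization of $(X,\delta)$, if for all $x,y,z,w\in X$ the comparison ($<$, $=$ or $>$) of $\delta(x,y)$ with $\delta(z,w)$ in $L$ is the same as the comparison of the real numbers $d(x,y)$ and $d(z,w)$. An ordinal space is called semimetric-like if it has a realization which is a semimetric space. *)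

(* Defs.v *)
From mathcomp Require Import all_boot all_order all_algebra.
From mathcomp Require Import reals.

Set Implicit Arguments.
Unset Strict Implicit.
Unset Printing Implicit Defensive.

Import Order.TTheory GRing.Theory Num.Theory.

Local Open Scope ring_scope.

(* The minimal element 0 of the linearly ordered set L is [\bot]. *)
Definition is_ordinal_space (X : Type) (disp : Order.disp_t)
    (L : bOrderType disp) (delta : X -> X -> L) : Prop :=
  [/\ forall l : L, exists x y : X, delta x y = l,
      forall x y : X, delta x y = delta y x
    & forall x y : X, delta x y = \bot%O <-> x = y].

Definition is_semimetric (R : realType) (X : Type) (d : X -> X -> R) : Prop :=
  [/\ forall x y : X, 0 <= d x y,
      forall x y : X, d x y = d y x
    & forall x y : X, d x y = 0 <-> x = y].

(* [metricType] bundles a topology and a uniformity with the distance; here a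
   metric is only a function on the bare set X. *)
Definition is_metric (R : realType) (X : Type) (d : X -> X -> R) : Prop :=
  is_semimetric d /\ forall x y z : X, d x z <= d x y + d y z.

Definition has_ordinal_type (R : realType) (X : Type) (disp : Order.disp_t)
    (L : bOrderType disp) (delta : X -> X -> L) (d : X -> X -> R) : Prop :=
  forall x y z w : X,
    [/\ (delta x y < delta z w)%O <-> d x y < d z w,
        delta x y = delta z w <-> d x y = d z w
      & (delta x y > delta z w)%O <-> d x y > d z w].

Definition semimetric_like (R : realType) (X : Type) (disp : Order.disp_t)
    (L : bOrderType disp) (delta : X -> X -> L) : Prop :=
  exists d : X -> X -> R, is_semimetric d /\ has_ordinal_type delta d.

(* Main.v *)
Require Import Defs.
From mathcomp Require Import all_boot all_order all_algebra.
From mathcomp Require Import reals.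

Import Order.TTheory GRing.Theory Num.Theory.

Local Open Scope ring_scope.

(** The ordinal type depends only on how distances compare, so any
    realization may be composed with a strictly increasing map of the
    half-line that fixes 0.  Choosing such a map whose values at positive
    arguments all lie between 1 and 2 makes the triangle inequality automatic
    ([squeeze_is_metric]): for three distinct points, any distance is at most
    2 while the sum of two others is at least 1 + 1; if two of the points
    coincide the inequality is trivial. *)

(** For t > 0 this is 1 + t / (1 + t), written so that t occurs only once
    and monotonicity reduces to that of the inverse. *)
Definition squeeze {R : realType} (t : R) : R :=
  if t == 0 then 0 else 2 - (1 + t)^-1.

Lemma squeeze_bounds (R : realType) (t : R) :
  0 < t -> 1 <= squeeze t <= 2.
Proof.
move=> t_gt0; rewrite /squeeze gt_eqF //.
have t1_gt0 : 0 < 1 + t by rewrite addr_gt0.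
rewrite gerBl invr_ge0 (ltW t1_gt0) andbT lerBrDr -lerBrDl.
have -> : 2 - 1 = 1 :> R by rewrite -[2]/(1 + 1) addrK.
by rewrite invf_le1 // lerDl ltW.
Qed.

Lemma squeeze_ge0 (R : realType) (t : R) : 0 <= t -> 0 <= squeeze t.
Proof.
rewrite le_eqVlt => /predU1P[<-|/squeeze_bounds /andP[ge1 _]].
  by rewrite /squeeze eqxx.
exact: le_trans ler01 ge1.
Qed.

Lemma squeeze_le (R : realType) :
  {in Num.nneg &, {mono @squeeze R : s t / s <= t}}.
Proof.
apply: le_mono_in => s t; rewrite !nnegrE => s_ge0 t_ge0 st.
have t_gt0 : 0 < t by apply: le_lt_trans st.
move: s_ge0; rewrite le_eqVlt => /predU1P[s0|s_gt0].
  have /andP[ge1 _] := squeeze_bounds _ _ t_gt0.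
  by rewrite -s0 {1}/squeeze eqxx (lt_le_trans ltr01).
by rewrite /squeeze !gt_eqF // ltrD2l ltrN2 ltf_pV2 ?posrE ?addr_gt0 // ltrD2l.
Qed.

Lemma squeeze_lt (R : realType) :
  {in Num.nneg &, {mono @squeeze R : s t / s < t}}.
Proof. exact: leW_mono_in (@squeeze_le R). Qed.

Lemma squeeze_inj (R : realType) : {in Num.nneg &, injective (@squeeze R)}.
Proof. exact: inc_inj_in (@squeeze_le R). Qed.

Lemma squeeze_is_metric {R : realType} (X : Type) (d : X -> X -> R) :
  is_semimetric d -> is_metric (fun x y => squeeze (d x y)).
Proof.
move=> [d_ge0 dC d_eq0].
have squeeze0 : squeeze (0 : R) = 0 by rewrite /squeeze eqxx.
have dxx x : squeeze (d x x) = 0 by rewrite (d_eq0 x x).2.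
split; first split.
- by move=> x y; apply: squeeze_ge0.
- by move=> x y; rewrite dC.
- move=> x y; split=> [s0|->//]; apply/d_eq0.
  by apply: squeeze_inj; rewrite ?nnegrE // s0.
move=> x y z.
(* Equality on X need not be decidable, but vanishing of the distance is. *)
have [/d_eq0<-|xy_neq0] := eqVneq (d x y) 0; first by rewrite dxx add0r.
have [/d_eq0<-|yz_neq0] := eqVneq (d y z) 0; first by rewrite dxx addr0.
have bounds u v : d u v != 0 -> 1 <= squeeze (d u v) <= 2.
  by move=> uv_neq0; apply: squeeze_bounds; rewrite lt_neqAle eq_sym uv_neq0 d_ge0.
have /andP[xy_ge1 _] := bounds _ _ xy_neq0.
have /andP[yz_ge1 _] := bounds _ _ yz_neq0.
apply: (@le_trans _ _ (1 + 1)); last exact: lerD.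
have [->|/bounds/andP[_ //]] := eqVneq (d x z) 0.
by rewrite squeeze0 addr_ge0.
Qed.

Theorem proposition1p5 (R : realType) (X : Type) (disp : Order.disp_t)
    (L : bOrderType disp) (delta : X -> X -> L)
    (Hdelta : is_ordinal_space delta)
    (Hlike : semimetric_like R delta) :
  exists d : X -> X -> R, is_metric d /\ has_ordinal_type delta d.
Proof.
have [d [d_semi d_type]] := Hlike.
exists (fun x y => squeeze (d x y)); split; first exact: squeeze_is_metric.
have d_nneg x y : d x y \in Num.nneg by rewrite nnegrE; case: d_semi.
move=> x y z w; have [lt_d eq_d gt_d] := d_type x y z w.
rewrite !squeeze_lt //; split=> //.
split=> [/eq_d->//|/squeeze_inj eq_dd]; exact/eq_d/eq_dd.
Qed.
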